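(* Let $n\geq 3$, $j\in\{2,\dots,n-1\}$, $p\in[0,1)$ and $\lambda\in(0,1)$. Then there exist origin-symmetric convex bodies $K$ and $L$ in $\mathbb R^n$ such that $$V_j\big((1-\lambda)\cdot K+_p\lambda\cdot L\big)<V_j(K)^{1-\lambda}V_j(L)^{\lambda}\leq \Big((1-\lambda)V_j(K)^{p/j}+\lambda V_j(L)^{p/j}\Big)^{j/p},$$ where for $p=0$ the right-most expression is understood as $V_j(K)^{1-\lambda}V_j(L)^\lambda$.
   Context: A convex body is a compact convex subset of $\mathbb R^n$ with nonempty interior; it is (origin-)symmetric if $K=-K$. The support function is $h_K(x)=\max_{y\in K}\langle x,y\rangle$. For a continuous $f:\mathbb S^{n-1}\to(0,\infty)$, its Wulff shape $W(f)$ is the largest convex body whose support function is $\le f$ on $\mathbb S^{n-1}$. For convex bodies $K,L$ containing the origin in their interior, $\lambda\in(0,1)$, the $L_p$-Minkowski combination is $(1-\lambda)\cdot K+_p\lambda\cdot L:=W\big(((1-\lambda)h_K^p+\lambda h_L^p)^{1/p}\big)$ for $p\neq 0$ and $W(h_K^{1-\lambda}h_L^\lambda)$ for $p=0$. The intrinsic volumes $V_0(K),\dots,V_n(K)$ are defined by the Steiner formula $V_n(K+\rho B_2^n)=\sum_{j=0}^n\rho^{n-j}\kappa_{n-j}V_j(K)$ for $\rho>0$, where $V_n$ is volume, $B_2^n$ the Euclidean unit ball and $\kappa_d$ the volume of the $d$-dimensional unit ball. *)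

(* Defs.v *)
From HB Require Import structures.
From mathcomp Require Import all_boot all_order all_algebra.
From mathcomp Require Import all_classical all_reals all_analysis.
From Stdlib Require Import ClassicalEpsilon.
Set Implicit Arguments. Unset Strict Implicit. Unset Printing Implicit Defensive.
Import Order.TTheory GRing.Theory Num.Theory.
Import numFieldNormedType.Exports.
Local Open Scope classical_set_scope.
Local Open Scope ring_scope.

Section ConvexGeometry.
Variable R : realType.

Definition dotv (n : nat) (x y : 'rV[R]_n) : R := \sum_(i < n) x 0 i * y 0 i.

Definition unit_ball (n : nat) : set 'rV[R]_n := [set x | dotv x x <= 1].
Definition unit_sphere (n : nat) : set 'rV[R]_n := [set u | dotv u u = 1].

(* n-dimensional Lebesgue measure, defined as an iterated Lebesgue integral
   (Tonelli): vol_0 A = 1 iff the unique point of R^0 is in A,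
   vol_{m+1} A = \int_R vol_m (section of A at first coordinate t) dt. *)
Fixpoint volume (n : nat) : set 'rV[R]_n -> \bar R :=
  match n return set 'rV[R]_n -> \bar R with
  | 0 => fun A => if `[< A 0 >] then 1%E else 0%E
  | m.+1 => fun A =>
      (\int[@lebesgue_measure R]_(t in [set: R])
          volume [set y : 'rV[R]_m | A (row_mx (\row_(k < 1) t) y)])%E
  end.

Definition kappa (d : nat) : R := fine (volume (@unit_ball d)).

Definition convex_set (n : nat) (K : set 'rV[R]_n) : Prop :=
  forall x y t, K x -> K y -> 0 <= t <= 1 -> K (t *: x + (1 - t) *: y).

Definition convex_body (n : nat) (K : set 'rV[R]_n) : Prop :=
  convex_set K /\ compact K /\ (interior K !=set0).

Definition origin_symmetric (n : nat) (K : set 'rV[R]_n) : Prop :=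
  forall x, K x -> K (- x).

Definition support_fun (n : nat) (K : set 'rV[R]_n) (x : 'rV[R]_n) : R :=
  sup [set dotv x y | y in K].

(* Wulff shape (Alexandrov body) of f : S^{n-1} -> (0,oo): the largest
   convex body whose support function is <= f on S^{n-1}, i.e.
   W(f) = {x | <x,u> <= f(u) for all u in S^{n-1}}. *)
Definition wulff (n : nat) (f : 'rV[R]_n -> R) : set 'rV[R]_n :=
  [set x | forall u, @unit_sphere n u -> dotv x u <= f u].

Definition Lp_comb (n : nat) (p lam : R) (K L : set 'rV[R]_n) : set 'rV[R]_n :=
  if p == 0 then
    wulff (fun u => (support_fun K u `^ (1 - lam)) * (support_fun L u `^ lam))
  else
    wulff (fun u => ((1 - lam) * support_fun K u `^ p
                     + lam * support_fun L u `^ p) `^ (p^-1)).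

Definition parallel_body (n : nat) (K : set 'rV[R]_n) (rho : R) : set 'rV[R]_n :=
  [set z | exists x b, K x /\ @unit_ball n b /\ z = x + rho *: b].

Definition steiner_coeffs (n : nat) (K : set 'rV[R]_n) (V : nat -> R) : Prop :=
  forall rho : R, 0 < rho ->
    volume (parallel_body K rho) =
      (\sum_(j < n.+1) rho ^+ (n - j) * kappa (n - j) * V j)%:E.

(* intrinsic volumes V_0(K), ..., V_n(K): the (unique) coefficients in the
   Steiner formula *)
Definition intrinsic_volume (n : nat) (K : set 'rV[R]_n) (j : nat) : R :=
  epsilon (inhabits (fun _ : nat => 0)) (steiner_coeffs K) j.

End ConvexGeometry.

(* Main.v *)
(* The bodies are boxes, products of segments [-a_i, a_i].  The [p]-mean [M]
   behind the [L_p] combination is homogeneous and, as [p <= 1], superadditive;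
   hence the combination of two boxes is the box whose half-widths are the
   [p]-means of theirs.  Slicing gives the Steiner formula of a box, with
   [V_j = 2^j e_j(a)].

   If [j - 1] half-widths are [1] and the others are [d w_i] with [d] small, then
   [e_j] is [d * sum_i w_i] up to [O(d^2)].  So it is enough to find [u] and [v]
   with [sum_i M(u_i, v_i) < 1] although [sum_i u_i >= 1] and [sum_i v_i >= 1].
   For [u = (1, r, ..., r)] and [v = (r, ..., r, 1)] the former sum tends, as
   [r -> 0], to [(1 - lam)^(1/p) + lam^(1/p)], which is less than [1] if
   [0 < p < 1]; the geometric mean, [p = 0], is below all of these. *)
Require Import Defs.
From HB Require Import structures.
From mathcomp Require Import all_boot all_order all_algebra.
From mathcomp Require Import all_classical all_reals all_analysis.
From mathcomp Require Import measurable_realfun ring lra zify.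
Import Order.TTheory GRing.Theory Num.Theory.
Import numFieldNormedType.Exports.
Local Open Scope classical_set_scope.
Local Open Scope ring_scope.
Set Implicit Arguments.
Unset Strict Implicit.

Section LebesgueIntegral.
Context {R : realType}.
Local Notation mu := (@lebesgue_measure R).
Implicit Types (f : R -> \bar R) (A D : set R).

Lemma nondecreasing_emeasurable f :
  {homo f : s t / s <= t >-> (s <= t)%E} -> measurable_fun [set: R] f.
Proof.
move=> f_nd _; apply: (measurability _ (ErealGenCInfty.measurableE R)) => //.
move=> _ [_ [r ->] <-]; rewrite setTI; apply: is_interval_measurable => s t /=.
rewrite !in_itv/= !andbT => rs _ u /andP[su _].
by rewrite in_itv/= andbT (le_trans rs)// f_nd.
Qed.

Lemma nondecreasing_measurable_sub_sqr f (s : R) :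
  {homo f : r t / r <= t >-> (r <= t)%E} ->
  measurable_fun [set: R] (fun t => f (s - t ^+ 2)).
Proof.
move=> f_nd; apply: (measurableT_comp (nondecreasing_emeasurable f_nd)).
by apply: measurable_funB => //; exact: measurable_funX.
Qed.

Section AffineChangeOfVariable.
Variables c e : R.
Hypothesis c_gt0 : 0 < c.

Let affine : measurableTypeR R -> measurableTypeR R := fun t => c * t + e.

Let measurable_affine : measurable_fun [set: measurableTypeR R] affine.
Proof. by apply: measurable_funD => //; exact: measurable_funM. Qed.

Let scaled_pushforward : {measure set (measurableTypeR R) -> \bar R} :=
  mscale (NngNum (ltW c_gt0))
    (measure_function_pushforward__canonical__measure_function_Measure
       mu measurable_affine).

Let scaled_pushforwardE A : measurable A -> scaled_pushforward A = mu A.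
Proof.
move=> mA; apply/esym/lebesgue_measure_unique => // _ [[a b]] _ <-.
have preimageE : affine @^-1` `]a, b] = `](a - e) / c, (b - e) / c]%classic.
  apply/seteqP; split => t /=; rewrite !in_itv/= ltr_pdivrMr// ler_pdivlMr//;
  by rewrite ltrBlDr lerBrDr (mulrC t).
rewrite /scaled_pushforward/= /mscale/= /pushforward preimageE.
rewrite !lebesgue_measure_itv/= !lte_fin ltr_pM2r ?invr_gt0// ltrD2r.
case: ifPn => _; last by rewrite mule0.
by rewrite -EFinD -EFinM; congr EFin; field; rewrite gt_eqF.
Qed.

Lemma ge0_integral_affine D f : measurable D -> measurable_fun D f ->
  (forall t, D t -> (0 <= f t)%E) ->
  (\int[mu]_(t in D) f t =
   c%:E * \int[mu]_(t in (fun t => c * t + e)%R @^-1` D) f (c * t + e)%R)%E.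
Proof.
move=> mD mf f0; transitivity (\int[scaled_pushforward]_(t in D) f t)%E.
  by apply: eq_measure_integral => A mA _; exact/esym/scaled_pushforwardE.
rewrite ge0_integral_mscale//; congr (_ * _)%E.
by rewrite ge0_integral_pushforward// => t /set_mem; exact: f0.
Qed.

End AffineChangeOfVariable.

Lemma ge0_integralT_even f : measurable_fun [set: R] f ->
  (forall t, (0 <= f t)%E) -> f =1 f \o -%R ->
  (\int[mu]_t f t = 2%:E * \int[mu]_(t in `[0%R, +oo[) f t)%E.
Proof.
move=> mf f0 f_even.
have mfD D : measurable_fun D f by exact: measurable_funS mf.
rewrite -(setUv [set` `[0%R, +oo[]) ge0_integral_setU//; last 3 first.
- exact: measurableC.
- exact: mfD.
- exact/disj_setPCl.
rewrite setCitvr integral_itv_bndo_bndc// mule_natl mule2n; congr (_ + _)%E.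
by rewrite [RHS]ge0_integration_by_substitution0//; exact: eq_integral.
Qed.

End LebesgueIntegral.

Section SegmentDistance.
Context {R : realType}.
Local Notation mu := (@lebesgue_measure R).
Implicit Types a t : R.

Definition seg_dist a t : R := Num.max 0 (`|t| - a).

Lemma seg_dist_ge0 a t : 0 <= seg_dist a t.
Proof. by rewrite le_max lexx. Qed.

Lemma seg_dist_le a t s : `|t| <= a -> seg_dist a (t + s) <= `|s|.
Proof. by move=> ta; rewrite ge_max normr_ge0 /=; have := ler_normD t s; lra. Qed.

Lemma seg_dist_attained a t : 0 <= a ->
  exists2 x, `|x| <= a & `|t - x| = seg_dist a t.
Proof.
move=> a0; rewrite /seg_dist; have [ta|a_lt_t] := leP `|t| a.
  by exists t => //; rewrite subrr normr0 max_l ?subr_le0.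
have t0 : t != 0 by rewrite -normr_gt0 (le_lt_trans a0).
exists (a * Num.sg t); first by rewrite normrM normr_sg t0 mulr1 ger0_norm.
have -> : t - a * Num.sg t = (`|t| - a) * Num.sg t.
  by rewrite mulrBl [`|t| * _]mulrC -numEsg.
by rewrite normrM normr_sg t0 mulr1 ger0_norm ?max_r//; lra.
Qed.

Lemma measurable_seg_dist a : measurable_fun [set: R] (seg_dist a).
Proof. by apply: measurable_maxr => //; exact: measurable_funB. Qed.

Section Integral.
Variables (a : R) (g : R -> \bar R).
Hypotheses (a_ge0 : 0 <= a) (mg : measurable_fun [set: R] g).
Hypothesis g_ge0 : forall t, (0 <= g t)%E.

Let measurable_g_seg_dist : measurable_fun [set: R] (g \o seg_dist a).
Proof. by apply: measurableT_comp => //; exact: measurable_seg_dist. Qed.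

Lemma ge0_integral_seg_dist_below :
  (\int[mu]_(t in `[0%R, a[) g (seg_dist a t) = a%:E * g 0%R)%E.
Proof.
transitivity (\int[mu]_(t in `[0%R, a[) (cst (g 0%R)) t)%E.
  apply: eq_integral => t; rewrite inE/= in_itv/= => /andP[t0 ta].
  by rewrite /seg_dist ger0_norm// max_l// subr_le0 ltW.
rewrite integral_cst//= lebesgue_measure_itv/= lte_fin muleC; congr (_ * _)%E.
case: ltP => [_|a_le0]; first by rewrite -EFinD subr0.
by congr EFin; apply/le_anti; rewrite a_ge0.
Qed.

Lemma ge0_integral_seg_dist_above :
  (\int[mu]_(t in `[a, +oo[) g (seg_dist a t) = \int[mu]_(t in `[0%R, +oo[) g t)%E.
Proof.
rewrite (@ge0_integral_affine _ 1 a)// ?mul1e; last first.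
  exact: measurable_funS measurable_g_seg_dist.
have -> : (fun t => 1 * t + a) @^-1` `[a, +oo[ = `[0, +oo[%classic.
  by apply/seteqP; split => t /=; rewrite !in_itv/= !andbT mul1r lerDr.
apply: eq_integral => t; rewrite inE/= in_itv/= andbT => t0.
by rewrite /seg_dist mul1r ger0_norm ?addr_ge0// addrK max_r.
Qed.

Lemma ge0_integral_seg_dist :
  (\int[mu]_t g (seg_dist a t) = (2 * a)%:E * g 0%R + \int[mu]_t g `|t|%R)%E.
Proof.
have half_line : (\int[mu]_(t in `[0%R, +oo[) g (seg_dist a t) =
    a%:E * g 0%R + \int[mu]_(t in `[0%R, +oo[) g t)%E.
  rewrite -ge0_integral_seg_dist_below -ge0_integral_seg_dist_above.
  rewrite -ge0_integral_setU//.
  - by rewrite -itv_bndbnd_setU.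
  - exact: measurable_funS measurable_g_seg_dist.
  - by apply/disj_setPS => t /=; rewrite !in_itv/= andbT; lra.
rewrite ge0_integralT_even//; last by move=> t; rewrite /seg_dist /= normrN.
rewrite [X in (_ + X)%E]ge0_integralT_even//; last 2 first.
- exact: measurableT_comp.
- by move=> t /=; rewrite normrN.
rewrite half_line ge0_muleDr ?mule_ge0 ?integral_ge0// muleA EFinM.
congr (_ + _ * _)%E; apply: eq_integral => t.
by rewrite inE/= in_itv/= andbT => t0; rewrite ger0_norm.
Qed.

End Integral.
End SegmentDistance.

Section SumSublevel.
Context {R : realType}.
Local Notation mu := (@lebesgue_measure R).

Definition sum_sublevel n (f : 'I_n -> R -> R) (s : R) : set 'rV[R]_n :=
  [set x | \sum_(i < n) f i (x 0 i) <= s].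

Lemma volume_sum_sublevel0 (f : 'I_0 -> R -> R) s :
  volume (sum_sublevel f s) = if 0 <= s then 1%E else 0%E.
Proof.
by rewrite /= /sum_sublevel /= big_ord0; case: asboolP => [->|/negP/negbTE ->].
Qed.

Lemma volume_sum_sublevelS n (f : 'I_n.+1 -> R -> R) s :
  volume (sum_sublevel f s) =
  (\int[mu]_t volume (sum_sublevel (f \o lift ord0) (s - f ord0 t)))%E.
Proof.
apply: eq_integral => t _; congr volume; apply/seteqP.
have sumE (y : 'rV[R]_n) :
    \sum_(i < n.+1) f i (row_mx (\row_(k < 1) t) y 0 i) =
    f ord0 t + \sum_(i < n) f (lift ord0 i) (y 0 i).
  rewrite big_ord_recl; congr (f _ _ + _).
    by rewrite (_ : @ord0 n = lshift n (@ord0 0)) ?row_mxEl ?mxE//; exact: val_inj.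
  apply: eq_bigr => i _; rewrite (_ : lift ord0 i = rshift 1 i) ?row_mxEr//.
  exact: val_inj.
by split => y; rewrite /sum_sublevel /= sumE lerBrDl.
Qed.

End SumSublevel.

Section BallVolume.
Context {R : realType}.
Local Notation mu := (@lebesgue_measure R).

(* Balls and neighbourhoods are indexed by the square [s] of their radius, so that
   slicing at height [t] merely replaces [s] by [s - t ^+ 2]. *)
Definition ball_volume (d : nat) (s : R) : \bar R :=
  volume (sum_sublevel (fun (_ : 'I_d) (t : R) => t ^+ 2) s).

Lemma kappaE d : kappa R d = fine (ball_volume d 1).
Proof. by []. Qed.

Lemma ball_volumeS d s :
  ball_volume d.+1 s = (\int[mu]_t ball_volume d (s - t ^+ 2))%E.
Proof. exact: volume_sum_sublevelS. Qed.

Lemma ball_volume_ge0 d s : (0 <= ball_volume d s)%E.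
Proof.
elim: d s => [|d IHd] s; last by rewrite ball_volumeS integral_ge0.
by rewrite /ball_volume volume_sum_sublevel0; case: ifP.
Qed.

Lemma ball_volume_lt0 d s : s < 0 -> ball_volume d s = 0%E.
Proof.
elim: d s => [|d IHd] s s0.
  by rewrite /ball_volume volume_sum_sublevel0 leNgt s0.
rewrite ball_volumeS integral0_eq// => t _; apply: IHd.
by have := sqr_ge0 t; lra.
Qed.

Lemma ball_volume_nd d : {homo @ball_volume d : s s' / s <= s' >-> (s <= s')%E}.
Proof.
elim: d => [|d IHd] s s' ss'.
  rewrite /ball_volume !volume_sum_sublevel0; have [s0|_] := leP 0 s.
    by rewrite (le_trans s0 ss').
  by case: ifP.
rewrite !ball_volumeS; apply: ge0_le_integral => //.
- by move=> t _; exact: ball_volume_ge0.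
- exact: nondecreasing_measurable_sub_sqr.
- exact: nondecreasing_measurable_sub_sqr.
- by move=> t _; apply: IHd; rewrite lerB.
Qed.

Lemma measurable_ball_volume_slice d s :
  measurable_fun [set: R] (fun t => ball_volume d (s - t ^+ 2)).
Proof. by apply: nondecreasing_measurable_sub_sqr; exact: ball_volume_nd. Qed.

Lemma ball_volumeZ d (c s : R) : 0 < c ->
  ball_volume d (c ^+ 2 * s) = ((c ^+ d)%:E * ball_volume d s)%E.
Proof.
move=> c0; elim: d s => [|d IHd] s.
  by rewrite expr0 mul1e /ball_volume !volume_sum_sublevel0 pmulr_rge0 ?exprn_gt0.
rewrite !ball_volumeS (@ge0_integral_affine _ c 0)//; last 2 first.
- exact: measurable_ball_volume_slice.
- by move=> t _; exact: ball_volume_ge0.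
rewrite preimage_setT.
have sliceE t : ball_volume d (c ^+ 2 * s - (c * t + 0) ^+ 2) =
    ((c ^+ d)%:E * ball_volume d (s - t ^+ 2))%E.
  by rewrite addr0 exprMn -mulrBr IHd.
under eq_integral do rewrite sliceE.
rewrite ge0_integralZl//; last 3 first.
- exact: measurable_ball_volume_slice.
- by move=> t _; exact: ball_volume_ge0.
- by rewrite lee_fin exprn_ge0// ltW.
by rewrite muleA -EFinM -exprS.
Qed.

Lemma ball_volume_lty d s : (ball_volume d s < +oo)%E.
Proof.
elim: d s => [|d IHd] s.
  by rewrite /ball_volume volume_sum_sublevel0; case: ifP; rewrite ltry.
pose r := 1 + `|s|; pose D := `[(- r)%R, r]%classic.
have mD : measurable D by exact: measurable_itv.
have bounded_support t : (ball_volume d (s - t ^+ 2) <= (cst (ball_volume d s) \_ D) t)%E.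
  rewrite patchE; case: ifPn => [_|/negP tD].
    by apply: ball_volume_nd; rewrite gerBl sqr_ge0.
  rewrite ball_volume_lt0// subr_lt0 ltNge; apply/negP => t2_le_s; apply: tD.
  rewrite inE /D /= in_itv/= -ler_norml -(@ler_sqr _ `|t|) ?nnegrE ?addr_ge0//.
  rewrite real_normK ?num_real// /r.
  by have := ler_norm s; have := normr_ge0 s; nra.
rewrite ball_volumeS.
apply: (@le_lt_trans _ _ (\int[mu]_(t in D) cst (ball_volume d s) t)%E).
  rewrite [leRHS]integral_mkcond; apply: ge0_le_integral => //.
  - by move=> t _; exact: ball_volume_ge0.
  - exact: measurable_ball_volume_slice.
  - exact/(measurable_restrictT _ mD)/measurable_cst.
rewrite integral_cst//= lebesgue_measure_itv/= lte_mul_pinfty ?ball_volume_ge0//.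
- by rewrite ge0_fin_numE ?ball_volume_ge0.
- by case: ifP => _; rewrite ?ltry// -EFinB ltry.
Qed.

Lemma ball_volume_gt0 d s : 0 < s -> (0 < ball_volume d s)%E.
Proof.
elim: d s => [|d IHd] s s0.
  by rewrite /ball_volume volume_sum_sublevel0 (ltW s0).
pose r := Num.min 1 (s / 2); pose D := `[0%R, r]%classic.
have mD : measurable D by exact: measurable_itv.
have r0 : 0 < r by rewrite lt_min ltr01 divr_gt0.
rewrite ball_volumeS.
apply: (@lt_le_trans _ _ (\int[mu]_(t in D) cst (ball_volume d (s / 2)) t)%E).
  rewrite integral_cst//= lebesgue_measure_itv/= lte_fin r0 -EFinB subr0.
  by rewrite mule_gt0 ?lte_fin// IHd// divr_gt0.
rewrite integral_mkcond; apply: ge0_le_integral => //.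
- by move=> t _; apply: erestrict_ge0 => u _; exact: ball_volume_ge0.
- exact/(measurable_restrictT _ mD)/measurable_cst.
- exact: measurable_ball_volume_slice.
move=> t _; rewrite patchE; case: ifPn => [|_]; last exact: ball_volume_ge0.
rewrite inE /D /= in_itv/= le_min => /and3P[t0 t1 ts]; apply: ball_volume_nd.
by rewrite expr2; nra.
Qed.

Definition steiner_sum (n : nat) (c : nat -> R) (s : R) : \bar R :=
  (\sum_(j < n.+1) (c j)%:E * ball_volume (n - j) s)%E.

Section SteinerSum.
Variable c : nat -> R.
Hypothesis c_ge0 : forall j, 0 <= c j.

Lemma steiner_sum_ge0 n s : (0 <= steiner_sum n c s)%E.
Proof. by apply: sume_ge0 => j _; rewrite mule_ge0 ?lee_fin ?ball_volume_ge0. Qed.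

Lemma measurable_steiner_sum_slice n s :
  measurable_fun [set: R] (fun t => steiner_sum n c (s - t ^+ 2)).
Proof.
apply: emeasurable_sum => j; apply: measurable_funeM.
exact: measurable_ball_volume_slice.
Qed.

Lemma integral_steiner_sum n s : c n.+1 = 0 ->
  (\int[mu]_t steiner_sum n c (s - t ^+ 2))%E = steiner_sum n.+1 c s.
Proof.
move=> c0; rewrite /steiner_sum big_ord_recr /= c0 mul0e adde0.
rewrite ge0_integral_sum//; last 2 first.
- by move=> j; apply: measurable_funeM; exact: measurable_ball_volume_slice.
- by move=> j t _; rewrite mule_ge0 ?lee_fin ?ball_volume_ge0.
apply: eq_bigr => j _; rewrite subSn -1?ltnS// ball_volumeS ge0_integralZl//.
- exact: measurable_ball_volume_slice.
- by move=> t _; exact: ball_volume_ge0.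
- by rewrite lee_fin.
Qed.

Lemma steiner_sum_recl n b c' s : 0 <= b ->
  c' 0%N = c 0%N -> (forall j, c' j.+1 = c j.+1 + b * c j) ->
  steiner_sum n.+1 c' s = (b%:E * steiner_sum n c s + steiner_sum n.+1 c s)%E.
Proof.
move=> b_ge0 c'0 c'S.
have term_ge0 j d : (0 <= (c j)%:E * ball_volume d s)%E.
  by rewrite mule_ge0 ?lee_fin ?ball_volume_ge0.
rewrite addeC /steiner_sum big_ord_recl [in RHS](big_ord_recl n.+1) c'0 -addeA.
congr (_ + _)%E; rewrite ge0_sume_distrr// -big_split; apply: eq_bigr => j _.
rewrite !lift0 /= subSS c'S muleA -EFinM -ge0_muleDl ?lee_fin ?c_ge0//.
by rewrite mulr_ge0 ?c_ge0.
Qed.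

End SteinerSum.
End BallVolume.

Section ElementarySymmetric.
Context {R : comNzRingType}.

Definition elemsym n (w : 'I_n -> R) (j : nat) : R :=
  (\prod_(i < n) (1 + w i *: 'X))`_j.

Lemma elemsym_nil (w : 'I_0 -> R) j : elemsym w j = (j == 0%N)%:R.
Proof. by rewrite /elemsym big_ord0 coef1. Qed.

Lemma elemsym_recl n (w : 'I_n.+1 -> R) j :
  elemsym w j.+1 = elemsym (w \o lift ord0) j.+1 + w ord0 * elemsym (w \o lift ord0) j.
Proof.
by rewrite /elemsym big_ord_recl mulrDl mul1r coefD -scalerAl coefZ coefXM.
Qed.

Lemma elemsym0 n (w : 'I_n -> R) : elemsym w 0 = 1.
Proof.
rewrite /elemsym -horner_coef0 horner_prod big1// => i _.
by rewrite !hornerE.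
Qed.

Lemma elemsym1 n (w : 'I_n -> R) : elemsym w 1 = \sum_i w i.
Proof.
elim: n w => [|n IHn] w; first by rewrite elemsym_nil big_ord0.
by rewrite elemsym_recl elemsym0 mulr1 IHn big_ord_recl addrC.
Qed.

Lemma elemsym_gt n (w : 'I_n -> R) j : (n < j)%N -> elemsym w j = 0.
Proof.
elim: n w j => [|n IHn] w [//|j] nj; first by rewrite elemsym_nil.
by rewrite elemsym_recl !IHn ?mulr0 ?addr0// ltnW.
Qed.

End ElementarySymmetric.

Section ElementarySymmetricBounds.
Context {R : realDomainType}.

Lemma elemsym_ge0 n (w : 'I_n -> R) j : (forall i, 0 <= w i) -> 0 <= elemsym w j.
Proof.
elim: n w j => [|n IHn] w j w0; first by rewrite elemsym_nil ler0n.
case: j => [|j]; first by rewrite elemsym0.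
by rewrite elemsym_recl addr_ge0 ?mulr_ge0 ?IHn// => i; exact: w0.
Qed.

Lemma elemsym_le_sum_exp n (w : 'I_n -> R) j :
  (forall i, 0 <= w i) -> elemsym w j <= (\sum_i w i) ^+ j.
Proof.
elim: n w j => [|n IHn] w j w0.
  by rewrite elemsym_nil big_ord0 expr0n.
case: j => [|j]; first by rewrite elemsym0.
rewrite elemsym_recl big_ord_recl; set v := w \o lift ord0; set S := \sum_(i < n) _.
have S0 : 0 <= S by rewrite sumr_ge0.
have v_le i : elemsym v i <= S ^+ i by apply: IHn => l; exact: w0.
apply: (@le_trans _ _ ((w ord0 + S) * S ^+ j)).
  by rewrite mulrDl -exprS addrC lerD// ler_wpM2l.
by rewrite exprS ler_wpM2l ?addr_ge0// lerXn2r ?nnegrE ?addr_ge0// lerDr.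
Qed.

End ElementarySymmetricBounds.

Definition fcons T n (x : T) (w : 'I_n -> T) : 'I_n.+1 -> T :=
  fun i => if unlift ord0 i is Some l then w l else x.

Lemma fcons_ord0 T n (x : T) (w : 'I_n -> T) : fcons x w ord0 = x.
Proof. by rewrite /fcons unlift_none. Qed.

Lemma fcons_lift T n (x : T) (w : 'I_n -> T) : fcons x w \o lift ord0 = w.
Proof. by apply/funext => i; rewrite /fcons /= liftK. Qed.

Fixpoint prepend_ones (R : nzRingType) k n (w : 'I_n -> R) : 'I_(k + n) -> R :=
  match k return 'I_(k + n) -> R with
  | 0 => w
  | k'.+1 => fcons 1 (@prepend_ones R k' n w)
  end.
Arguments prepend_ones {R} k {n} w i.

Section PrependOnes.
Context {R : realDomainType}.

Lemma prepend_ones_map2 (g : R -> R -> R) k n (u v : 'I_n -> R) : g 1 1 = 1 ->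
  (fun i => g (prepend_ones k u i) (prepend_ones k v i)) =
  prepend_ones k (fun i => g (u i) (v i)).
Proof.
move=> g11; elim: k => //= k IHk; apply/funext => i.
by rewrite /fcons; case: unliftP => // l _; rewrite -IHk.
Qed.

Lemma prepend_ones_gt0 k n (w : 'I_n -> R) :
  (forall i, 0 < w i) -> forall i, 0 < prepend_ones k w i.
Proof. by move=> w0; elim: k => //= k IHk i; rewrite /fcons; case: unliftP. Qed.

Lemma prepend_ones_ge0 k n (w : 'I_n -> R) :
  (forall i, 0 <= w i) -> forall i, 0 <= prepend_ones k w i.
Proof. by move=> w0; elim: k => //= k IHk i; rewrite /fcons; case: unliftP. Qed.

Lemma elemsym_prepend_onesS k n (w : 'I_n -> R) j :
  elemsym (prepend_ones k.+1 w) j.+1 =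
  elemsym (prepend_ones k w) j.+1 + elemsym (prepend_ones k w) j.
Proof. by rewrite elemsym_recl /= fcons_lift fcons_ord0 mul1r. Qed.

Lemma sum_le_elemsym_prepend_ones k n (w : 'I_n -> R) : (forall i, 0 <= w i) ->
  \sum_i w i <= elemsym (prepend_ones k w) k.+1.
Proof.
move=> w0; elim: k => [|k IHk]; first by rewrite elemsym1.
rewrite elemsym_prepend_onesS (le_trans IHk)// lerDr elemsym_ge0//.
exact: prepend_ones_ge0.
Qed.

Lemma elemsym_prepend_ones_le k n (w : 'I_n -> R) j : (forall i, 0 <= w i) ->
  elemsym (prepend_ones k w) (k + j) <= (\sum_i w i) ^+ j * (1 + \sum_i w i) ^+ k.
Proof.
move=> w0; set S := \sum_i w i; elim: k j => [|k IHk] j.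
  by rewrite expr0 mulr1 elemsym_le_sum_exp.
have -> : S ^+ j * (1 + S) ^+ k.+1 = S ^+ j.+1 * (1 + S) ^+ k + S ^+ j * (1 + S) ^+ k.
  by rewrite !exprS; ring.
rewrite [(k.+1 + j)%N]addSn elemsym_prepend_onesS lerD ?IHk// -addnS; exact: IHk.
Qed.

End PrependOnes.

Section Box.
Context {R : realType}.
Local Notation mu := (@lebesgue_measure R).

Definition box n (a : 'I_n -> R) : set 'rV[R]_n := [set x | forall i, `|x 0 i| <= a i].

Lemma convex_box n (a : 'I_n -> R) : Defs.convex_set (box a).
Proof.
move=> x y t xa ya /andP[t0 t1] i; have tC0 : 0 <= 1 - t by rewrite subr_ge0.
rewrite !mxE (le_trans (ler_normD _ _))// !normrM (ger0_norm t0) (ger0_norm tC0).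
have -> : a i = t * a i + (1 - t) * a i by ring.
by rewrite lerD// ler_wpM2l.
Qed.

Lemma origin_symmetric_box n (a : 'I_n -> R) : origin_symmetric (box a).
Proof. by move=> x xa i; rewrite mxE normrN. Qed.

Lemma compact_box n (a : 'I_n -> R) : compact (box a).
Proof.
have -> : box a = [set x | forall i, `[- a i, a i]%classic (x ord0 i)].
  by apply/seteqP; split => x xa i; have := xa i; rewrite /= in_itv/= ler_norml.
apply: (@rV_compact _ _ (fun i => `[- a i, a i]%classic)) => i.
exact: segment_compact.
Qed.

Lemma interior_box_neq0 n (a : 'I_n -> R) : (forall i, 0 < a i) -> interior (box a) !=set0.
Proof.
move=> a0; exists 0; pose e := \big[Num.min/1]_i a i.
have e0 : 0 < e by exact: lt_bigmin.
apply/nbhs_ballP; exists e => //= x [_ /(_ 0) xe] i.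
have /ltW := xe i; rewrite mxE sub0r normrN => /le_trans; apply.
exact: bigmin_le_cond.
Qed.

Lemma convex_body_box n (a : 'I_n -> R) : (forall i, 0 < a i) -> convex_body (box a).
Proof.
move=> a0; split; first exact: convex_box.
by split; [exact: compact_box | exact: interior_box_neq0].
Qed.

Lemma support_fun_box n (a : 'I_n -> R) u : (forall i, 0 <= a i) ->
  support_fun (box a) u = \sum_i a i * `|u 0 i|.
Proof.
move=> a0; rewrite /support_fun.
set E := [set dotv u y | y in box a]; set h := \sum_i _.
have h_ub : ubound E h.
  move=> _ [y ya <-]; apply: ler_sum => i _.
  by rewrite (le_trans (ler_norm _))// normrM mulrC ler_wpM2r.
have h_attained : E h.
  exists (\row_i (a i * Num.sg (u 0 i))).
    move=> i; rewrite mxE normrM ger0_norm// ler_piMr//.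
    by rewrite normr_sg; case: (_ == 0).
  by apply: eq_bigr => i _; rewrite mxE mulrCA normrEsg [u 0 i * _]mulrC.
apply/le_anti/andP; split; first by apply: ge_sup => //; exists h.
by apply: ub_le_sup => //; exists h.
Qed.

Definition box_nbhd n (a : 'I_n -> R) : R -> set 'rV[R]_n :=
  sum_sublevel (fun i t => seg_dist (a i) t ^+ 2).

Lemma parallel_body_box n (a : 'I_n -> R) (rho : R) : (forall i, 0 <= a i) ->
  0 < rho -> parallel_body (box a) rho = box_nbhd a (rho ^+ 2).
Proof.
move=> a0 r0; rewrite /box_nbhd /sum_sublevel; apply/seteqP; split => z /=.
  move=> [x [b [xa [b1 ->]]]]; apply: (@le_trans _ _ (rho ^+ 2 * dotv b b)); last first.
    by rewrite ler_piMr ?sqr_ge0.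
  rewrite /dotv mulr_sumr; apply: ler_sum => i _; rewrite !mxE -expr2 -exprMn.
  rewrite -[leRHS]real_normK ?num_real// lerXn2r ?nnegrE ?seg_dist_ge0//.
  exact: seg_dist_le.
move=> z_near.
have [y y_box y_nearest] := fin_all_exists2 (fun i => seg_dist_attained (z 0 i) (a0 i)).
exists (\row_i y i), (rho^-1 *: (z - \row_i y i)); split; first by move=> i; rewrite mxE.
split; last by rewrite scalerA divff ?gt_eqF// scale1r addrC subrK.
rewrite /unit_ball /= /dotv (_ : \sum_(i < n) _ =
    (rho ^+ 2)^-1 * \sum_(i < n) seg_dist (a i) (z 0 i) ^+ 2).
  by rewrite ler_pdivrMl ?exprn_gt0// mulr1.
rewrite mulr_sumr; apply: eq_bigr => i _.
by rewrite !mxE -expr2 exprMn exprVn -y_nearest real_normK ?num_real.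
Qed.

Lemma volume_box_nbhd n (a : 'I_n -> R) s : (forall i, 0 <= a i) ->
  volume (box_nbhd a s) = steiner_sum n (fun j => 2 ^+ j * elemsym a j) s.
Proof.
elim: n a s => [|n IHn] a s a0.
  rewrite /steiner_sum big_ord1 elemsym0 mul1r mul1e.
  by rewrite /box_nbhd /ball_volume !volume_sum_sublevel0.
pose c j := 2 ^+ j * elemsym (a \o lift ord0) j.
have tail_ge0 i : 0 <= (a \o lift ord0) i by exact: a0.
have c_ge0 j : 0 <= c j by rewrite mulr_ge0 ?exprn_ge0 ?elemsym_ge0.
rewrite volume_sum_sublevelS.
transitivity (\int[mu]_t steiner_sum n c (s - seg_dist (a ord0) t ^+ 2))%E.
  by apply: eq_integral => t _; exact: IHn.
rewrite (@ge0_integral_seg_dist _ _ (fun t => steiner_sum n c (s - t ^+ 2)))//;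
  last 2 first.
- exact: measurable_steiner_sum_slice.
- by move=> t; exact: steiner_sum_ge0.
under eq_integral do rewrite real_normK ?num_real//.
rewrite integral_steiner_sum//; last by rewrite /c elemsym_gt ?mulr0.
rewrite expr0n subr0; apply/esym/steiner_sum_recl => //.
- by rewrite mulr_ge0.
- by rewrite /c !elemsym0.
- by move=> j; rewrite /c elemsym_recl exprS; ring.
Qed.

Lemma steiner_coeffs_unique n (K : set 'rV[R]_n) (V W : nat -> R) j :
  (j <= n)%N -> steiner_coeffs K V -> steiner_coeffs K W -> V j = W j.
Proof.
move=> jn KV KW.
pose P := \poly_(k < n.+1) (kappa R k * (V (n - k)%N - W (n - k)%N)).
have P_eq0_gt0 r : 0 < r -> P.[r] = 0.
  move=> r0; have := KW r r0; rewrite KV// => -[] /eqP.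
  rewrite -subr_eq0 -sumrB => /eqP VW0.
  rewrite horner_poly (reindex_inj rev_ord_inj)/= -[RHS]VW0.
  apply: eq_bigr => i _; rewrite subSS subKn -1?ltnS//; ring.
have P0 : P = 0.
  apply: (@roots_geq_poly_eq0 _ P [seq k.+1%:R | k <- iota 0 n.+1]).
  - by apply/allP => _ /mapP[k _ ->]; rewrite rootE P_eq0_gt0.
  - by rewrite map_inj_uniq ?iota_uniq// => k l /eqP; rewrite eqr_nat eqSS => /eqP.
  - by rewrite size_map size_iota size_poly.
have /eqP : P`_(n - j) = 0 by rewrite P0 coef0.
rewrite coef_poly ltnS leq_subr subKn// mulf_eq0 gt_eqF ?subr_eq0 => [/eqP//|].
by rewrite kappaE fine_gt0// ball_volume_gt0// ball_volume_lty.
Qed.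

Lemma steiner_coeffs_box n (a : 'I_n -> R) : (forall i, 0 <= a i) ->
  steiner_coeffs (box a) (fun j => 2 ^+ j * elemsym a j).
Proof.
move=> a0 rho rho0; rewrite parallel_body_box// volume_box_nbhd// -sumEFin.
apply: eq_bigr => j _; rewrite -[rho ^+ 2]mulr1 ball_volumeZ// kappaE.
rewrite -[ball_volume _ _]fineK ?ge0_fin_numE ?ball_volume_ge0 ?ball_volume_lty//.
by rewrite -!EFinM mulrC.
Qed.

Lemma intrinsic_volume_box n (a : 'I_n -> R) j : (forall i, 0 <= a i) ->
  (j <= n)%N -> intrinsic_volume (box a) j = 2 ^+ j * elemsym a j.
Proof.
move=> a0 jn; have coeffs := steiner_coeffs_box a0.
apply: (steiner_coeffs_unique jn _ coeffs).
exact: (ClassicalEpsilon.epsilon_spec (inhabits _) _ (ex_intro _ _ coeffs)).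
Qed.

End Box.

Lemma lt01W (R : numDomainType) (x : R) : 0 < x < 1 -> 0 <= x <= 1.
Proof. by case/andP => /ltW-> /ltW->. Qed.

Lemma sum_normalize (R : realFieldType) (I : finType) (f : I -> R) (F := \sum_i f i) :
  (forall i, 0 <= f i) ->
  [/\ forall i, 0 <= f i / F, forall i, F * (f i / F) = f i & \sum_i f i / F <= 1].
Proof.
move=> f_ge0; have F_ge0 : 0 <= F by exact: sumr_ge0.
split=> [i|i|]; first by rewrite divr_ge0.
- have [F0|F0] := eqVneq F 0; last by rewrite mulrC divfK.
  by rewrite F0 mul0r (psumr_eq0P _ F0).
- rewrite -mulr_suml -/F; have [->|F0] := eqVneq F 0; first by rewrite mul0r.
  by rewrite divff.
Qed.

Section RealPowers.
Context {R : realType}.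
Implicit Types p q t x y : R.

Lemma powR_powRV p x : p != 0 -> 0 <= x -> (x `^ p) `^ p^-1 = x.
Proof. by move=> p0 x0; rewrite -powRrM mulfV// powRr1. Qed.

Lemma gt1r_powR x q : 0 < x < 1 -> 1 < q -> x `^ q < x.
Proof.
move=> /andP[x0 x1] q1; have : x `^ (q - 1) < 1 `^ (q - 1).
  by apply: gt0_ltr_powR; rewrite ?subr_gt0 ?nnegrE ?ltW.
by rewrite powR1 -(mulr_powRB1 (ltW x0) (lt_trans ltr01 q1)) gtr_pMr.
Qed.

Lemma powR_convex q t x y : 1 <= q -> 0 <= t <= 1 -> 0 <= x -> 0 <= y ->
  ((1 - t) * x + t * y) `^ q <= (1 - t) * x `^ q + t * y `^ q.
Proof.
move=> q1 /andP[t0 t1] x0 y0; have tC_ge0 : 0 <= 1 - t by rewrite subr_ge0.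
have tC_le1 : 1 - t <= 1 by rewrite gerBl.
rewrite -{2 4}(subKr 1 t).
by apply: (convex_powR q1 (Itv01 tC_ge0 tC_le1)); rewrite inE /= in_itv/= andbT.
Qed.

Lemma weighted_AGM t x y : 0 <= t <= 1 -> 0 <= x -> 0 <= y ->
  x `^ (1 - t) * y `^ t <= (1 - t) * x + t * y.
Proof.
move=> /andP[t_ge0 t_le1] x0 y0; have tC_ge0 : 0 <= 1 - t by rewrite subr_ge0.
have [->|t0] := eqVneq t 0.
  by rewrite subr0 powRr0 powRr1// mulr1 mul1r mul0r addr0.
have [tC0|tC0] := eqVneq (1 - t) 0.
  by rewrite tC0 powRr0 -(subKr 1 t) tC0 subr0 powRr1// !mul1r mul0r add0r.
have := @conjugate_powR R (x `^ (1 - t)) (y `^ t) (1 - t)^-1 t^-1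
  (powR_ge0 _ _) (powR_ge0 _ _).
rewrite !invr_gt0 !invrK subrK !lt0r t_ge0 tC_ge0 t0 tC0 => /(_ isT isT erefl).
by rewrite !powR_powRV// ![_ * (1 - t)]mulrC [_ * t]mulrC.
Qed.

End RealPowers.

Section LpMean.
Context {R : realType}.
Implicit Types p lam x y : R.

Definition Lp_mean p lam x y : R :=
  if p == 0 then x `^ (1 - lam) * y `^ lam
  else ((1 - lam) * x `^ p + lam * y `^ p) `^ p^-1.

Lemma Lp_mean0E lam x y : Lp_mean 0 lam x y = x `^ (1 - lam) * y `^ lam.
Proof. by rewrite /Lp_mean eqxx. Qed.

Lemma Lp_meanE p lam x y : p != 0 ->
  Lp_mean p lam x y = ((1 - lam) * x `^ p + lam * y `^ p) `^ p^-1.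
Proof. by move=> /negbTE p0; rewrite /Lp_mean p0. Qed.

Lemma Lp_mean_ge0 p lam x y : 0 <= Lp_mean p lam x y.
Proof. by rewrite /Lp_mean; case: ifP => _; rewrite ?powR_ge0// mulr_ge0 ?powR_ge0. Qed.

Lemma Lp_meanC p lam x y : Lp_mean p lam x y = Lp_mean p (1 - lam) y x.
Proof. by rewrite /Lp_mean subKr mulrC [X in X `^ p^-1]addrC. Qed.

Section Weight.
Variable lam : R.
Hypothesis lam01 : 0 <= lam <= 1.

Let lam_ge0 : 0 <= lam. Proof. by case/andP: lam01. Qed.
Let lamC_ge0 : 0 <= 1 - lam. Proof. by case/andP: lam01; rewrite subr_ge0. Qed.

Let power_sum_ge0 p x y : 0 <= (1 - lam) * x `^ p + lam * y `^ p.
Proof. by rewrite addr_ge0 ?mulr_ge0 ?powR_ge0. Qed.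

Lemma Lp_mean_scale p c x y : 0 <= c -> 0 <= x -> 0 <= y ->
  Lp_mean p lam (c * x) (c * y) = c * Lp_mean p lam x y.
Proof.
move=> c0 x0 y0; have [->|p0] := eqVneq p 0.
  by rewrite !Lp_mean0E !powRM// mulrACA -powRD ?subrK ?powRr1// oner_eq0.
rewrite !Lp_meanE// !powRM// mulrCA [lam * _]mulrCA -mulrDr powRM ?powR_ge0//.
by rewrite powR_powRV.
Qed.

Lemma Lp_mean_id p x : 0 <= x -> Lp_mean p lam x x = x.
Proof.
move=> x0; have [->|p0] := eqVneq p 0.
  by rewrite Lp_mean0E -powRD ?subrK ?powRr1// oner_eq0.
by rewrite Lp_meanE// -mulrDl subrK mul1r powR_powRV.
Qed.

Lemma Lp_mean_le p x y x' y' : 0 <= p -> 0 <= x <= x' -> 0 <= y <= y' ->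
  Lp_mean p lam x y <= Lp_mean p lam x' y'.
Proof.
move=> p_ge0 /andP[x0 xx'] /andP[y0 yy'].
have x'0 := le_trans x0 xx'; have y'0 := le_trans y0 yy'.
have [->|p0] := eqVneq p 0.
  by rewrite !Lp_mean0E ler_pM ?powR_ge0// ge0_ler_powR.
rewrite 2!(Lp_meanE _ _ _ p0); apply: ge0_ler_powR.
- by rewrite invr_ge0.
- exact: power_sum_ge0.
- exact: power_sum_ge0.
- by apply: lerD; apply: ler_wpM2l => //; exact: ge0_ler_powR.
Qed.

Lemma min_le_Lp_mean p x y : 0 <= p -> 0 <= x -> 0 <= y ->
  Num.min x y <= Lp_mean p lam x y.
Proof.
move=> p_ge0 x0 y0; have min_ge0 : 0 <= Num.min x y by rewrite le_min x0.
rewrite -[leLHS](Lp_mean_id p min_ge0).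
by apply: (Lp_mean_le p_ge0); rewrite min_ge0 ge_min lexx ?orbT.
Qed.

Lemma Lp_mean_le_arithmetic p x y : 0 <= p <= 1 -> 0 <= x -> 0 <= y ->
  Lp_mean p lam x y <= (1 - lam) * x + lam * y.
Proof.
move=> /andP[p_ge0 p1] x0 y0; have [->|p0] := eqVneq p 0.
  by rewrite Lp_mean0E weighted_AGM.
have p_gt0 : 0 < p by rewrite lt0r p0.
have pV_ge1 : 1 <= p^-1 by rewrite invf_ge1.
rewrite Lp_meanE// -{2}(powR_powRV p0 x0) -{2}(powR_powRV p0 y0).
by rewrite powR_convex ?powR_ge0.
Qed.

Lemma Lp_mean0_powR q x y :
  Lp_mean 0 lam (x `^ q) (y `^ q) = Lp_mean 0 lam x y `^ q.
Proof.
rewrite !Lp_mean0E (powRM q (powR_ge0 x (1 - lam)) (powR_ge0 y lam)).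
by rewrite (powRAC x q (1 - lam)) (powRAC y q lam).
Qed.

Lemma Lp_mean0_le q x y : 0 <= q -> Lp_mean 0 lam x y <= Lp_mean q lam x y.
Proof.
move=> q_ge0; have [->//|q0] := eqVneq q 0.
rewrite -[leLHS](powR_powRV q0 (Lp_mean_ge0 0 lam x y)) -Lp_mean0_powR.
rewrite (Lp_meanE _ _ _ q0) Lp_mean0E; apply: ge0_ler_powR.
- by rewrite invr_ge0.
- by rewrite nnegrE mulr_ge0 ?powR_ge0.
- exact: power_sum_ge0.
- by rewrite weighted_AGM ?powR_ge0.
Qed.

Lemma Lp_mean_reweight p x0 y0 : 0 <= x0 -> 0 <= y0 ->
  exists2 beta, 0 <= beta <= 1 & forall x y, 0 <= x -> 0 <= y ->
    Lp_mean p lam (x0 * x) (y0 * y) = Lp_mean p lam x0 y0 * Lp_mean p beta x y.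
Proof.
move=> x0_ge0 y0_ge0; have [->|p0] := eqVneq p 0.
  by exists lam => // x y x_ge0 y_ge0; rewrite !Lp_mean0E !powRM// mulrACA.
pose S := (1 - lam) * x0 `^ p + lam * y0 `^ p.
have S_ge0 : 0 <= S by exact: power_sum_ge0.
(* If [S = 0], then [beta] is [0] by the convention [x / 0 = 0], which is harmless
   since both sides of the identity vanish. *)
pose beta := lam * y0 `^ p / S.
have beta_ge0 : 0 <= beta by rewrite divr_ge0 ?mulr_ge0 ?powR_ge0.
have beta_le1 : beta <= 1.
  rewrite /beta; have [->|S0] := eqVneq S 0; first by rewrite invr0 mulr0.
  by rewrite ler_pdivrMr ?lt0r ?S0// mul1r lerDr mulr_ge0 ?powR_ge0.
exists beta; first by rewrite beta_ge0.
move=> x y x_ge0 y_ge0; rewrite 3!(Lp_meanE _ _ _ p0) -/S.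
rewrite (powRM p x0_ge0 x_ge0) (powRM p y0_ge0 y_ge0).
have [S0|S0] := eqVneq S 0.
  move/eqP: (S0); rewrite paddr_eq0 ?mulr_ge0 ?powR_ge0// => /andP[/eqP x0E /eqP y0E].
  by rewrite !mulrA x0E y0E S0 !mul0r addr0 powR0 ?invr_eq0// mul0r.
rewrite -(powRM _ S_ge0); first by congr (_ `^ _); rewrite /beta /S; field.
by apply: addr_ge0; apply: mulr_ge0; rewrite ?powR_ge0 ?subr_ge0.
Qed.

End Weight.

Lemma Lp_mean_sum_le (I : finType) (f g : I -> R) p lam :
  0 <= p <= 1 -> 0 <= lam <= 1 -> (forall i, 0 <= f i) -> (forall i, 0 <= g i) ->
  \sum_i Lp_mean p lam (f i) (g i) <= Lp_mean p lam (\sum_i f i) (\sum_i g i).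
Proof.
move=> p01 lam01 f_ge0 g_ge0; set F := \sum_i f i; set G := \sum_i g i.
have [u_ge0 Fu u_le1] := sum_normalize f_ge0.
have [v_ge0 Gv v_le1] := sum_normalize g_ge0.
have F_ge0 : 0 <= F by exact: sumr_ge0.
have G_ge0 : 0 <= G by exact: sumr_ge0.
have [beta /andP[beta0 beta1] reweight] := Lp_mean_reweight lam01 p F_ge0 G_ge0.
(* The middle term is linear in [(f, g)]: it is the tangent to the mean at [(F, G)]. *)
apply: (@le_trans _ _ (\sum_i Lp_mean p lam F G *
    ((1 - beta) * (f i / F) + beta * (g i / G)))).
  apply: ler_sum => i _; rewrite -{1}(Fu i) -{1}(Gv i) reweight//.
  by rewrite ler_wpM2l ?Lp_mean_ge0// Lp_mean_le_arithmetic// beta0.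
rewrite -mulr_sumr big_split/= -!mulr_sumr ler_piMr ?Lp_mean_ge0//.
apply: (@le_trans _ _ ((1 - beta) * 1 + beta * 1)); last by rewrite !mulr1 subrK.
by rewrite lerD// ler_wpM2l ?subr_ge0.
Qed.

End LpMean.

Section Spikes.
Context {R : realType}.
Implicit Types p lam r s : R.

Definition spike (I : eqType) (i0 : I) (r : R) (i : I) : R :=
  if i == i0 then 1 else r.

Lemma spike_gt0 (I : eqType) (i0 i : I) r : 0 < r -> 0 < spike i0 r i.
Proof. by rewrite /spike; case: ifP. Qed.

Lemma sum_spike_ge1 (I : finType) (i0 : I) r : 0 <= r -> 1 <= \sum_i spike i0 r i.
Proof.
move=> r0; rewrite (bigD1 i0)//= {1}/spike eqxx lerDl sumr_ge0// => i _.
by rewrite /spike; case: ifP.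
Qed.

Lemma Lp_mean_1_powRV_le p lam s : 0 < p <= 1 -> 0 <= lam <= 1 -> 0 <= s <= 1 ->
  Lp_mean p lam 1 (s `^ p^-1) <= (1 - s) * (1 - lam) `^ p^-1 + s.
Proof.
move=> /andP[p_gt0 p1] /andP[lam0 lam1] s01; have p0 : p != 0 by rewrite gt_eqF.
have s0 : 0 <= s by case/andP: s01.
rewrite (Lp_meanE _ _ _ p0) powR1 mulr1 -powRrM mulVf// powRr1//.
have -> : 1 - lam + lam * s = (1 - s) * (1 - lam) + s * 1 by ring.
rewrite (le_trans (powR_convex _ s01 _ _)) ?invf_ge1 ?subr_ge0//.
by rewrite powR1 mulr1.
Qed.

Lemma Lp_mean_spike_sum_le (I : finType) (i0 i1 : I) p lam r : i0 != i1 ->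
  0 <= lam <= 1 -> 0 <= r ->
  \sum_i Lp_mean p lam (spike i0 r i) (spike i1 r i) <=
  Lp_mean p lam 1 r + Lp_mean p lam r 1 + #|I|%:R * r.
Proof.
move=> i01 lam01 r0.
have i10 : (i1 == i0) = false by rewrite eq_sym; exact/negbTE.
rewrite (bigD1 i0)//= (bigD1 i1)/= ?i10//.
rewrite /spike !eqxx (negbTE i01) i10 addrA lerD2l.
rewrite (eq_bigr (fun=> r)) => [|i /andP[/negbTE -> /negbTE ->]]; last first.
  by rewrite Lp_mean_id.
by rewrite sumr_const mulr_natl ler_wpMn2l ?max_card.
Qed.

Lemma Lp_mean_swap_sum_le p lam : 0 < p < 1 -> 0 < lam < 1 ->
  exists2 c, 0 <= c < 1 & forall s, 0 <= s <= 1 ->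
    Lp_mean p lam 1 (s `^ p^-1) + Lp_mean p lam (s `^ p^-1) 1 <= (1 - s) * c + 2 * s.
Proof.
move=> /andP[p_gt0 p_lt1] /[dup] lam01_open /lt01W lam01.
have pV_gt1 : 1 < p^-1 by rewrite invf_gt1.
have p01 : 0 < p <= 1 by rewrite p_gt0 ltW.
have lamC01 : 0 <= 1 - lam <= 1 by lra.
exists ((1 - lam) `^ p^-1 + lam `^ p^-1).
  rewrite addr_ge0 ?powR_ge0//= -[ltRHS](subrK lam 1).
  by apply: ltrD; apply: gt1r_powR => //; lra.
move=> s s01; have M_le := Lp_mean_1_powRV_le p01 lam01 s01.
have M'_le := Lp_mean_1_powRV_le p01 lamC01 s01; rewrite subKr -Lp_meanC in M'_le.
by rewrite mulrDr mulr_natl mulr2n [leRHS]addrACA lerD.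
Qed.

Lemma gt0_exists_spike_Lp_mean_sum_lt1 (I : finType) (i0 i1 : I) p lam :
  i0 != i1 -> 0 < p < 1 -> 0 < lam < 1 ->
  exists2 r, 0 < r & \sum_i Lp_mean p lam (spike i0 r i) (spike i1 r i) < 1.
Proof.
move=> i01 p01 lam01; have lam01' := lt01W lam01.
have [c /andP[c_ge0 c_lt1] swap_le] := Lp_mean_swap_sum_le p01 lam01.
have pV_ge1 : 1 <= p^-1 by case/andP: p01 => *; rewrite invf_ge1// ltW.
have N_ge0 : 0 <= #|I|%:R :> R by [].
have [s sE] : exists s, (#|I|%:R + 3) * s = 1 - c.
  by exists ((1 - c) / (#|I|%:R + 3)); rewrite mulrC divfK// gt_eqF// ltr_wpDl.
have s_gt0 : 0 < s by nra.
have s_le1 : s <= 1 by nra.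
have r_le_s : s `^ p^-1 <= s by rewrite ge1r_powR ?s_gt0.
exists (s `^ p^-1); first exact: powR_gt0.
apply: (le_lt_trans (Lp_mean_spike_sum_le _ i01 lam01' (powR_ge0 _ _))).
apply: (@le_lt_trans _ _ ((1 - s) * c + 2 * s + #|I|%:R * s)); last by nra.
by apply: lerD; [apply: swap_le; rewrite ltW | exact: ler_wpM2l].
Qed.

Lemma exists_spike_Lp_mean_sum_lt1 (I : finType) (i0 i1 : I) p lam : i0 != i1 ->
  0 <= p < 1 -> 0 < lam < 1 ->
  exists2 r, 0 < r & \sum_i Lp_mean p lam (spike i0 r i) (spike i1 r i) < 1.
Proof.
move=> i01 /andP[p_ge0 p_lt1] lam01; have [p0|p0] := eqVneq p 0; last first.
  by apply: (gt0_exists_spike_Lp_mean_sum_lt1 i01 _ lam01); rewrite lt0r p0 p_ge0.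
have half01 : (0 : R) < (2 : R)^-1 < 1 by apply/andP; split; lra.
have [r r0 half_lt1] := gt0_exists_spike_Lp_mean_sum_lt1 i01 half01 lam01.
exists r; first exact: r0.
apply: le_lt_trans half_lt1; rewrite p0; apply: ler_sum => i _.
by apply: (Lp_mean0_le (lt01W lam01)); case/andP: half01 => /ltW.
Qed.

End Spikes.

Section LpCombinationOfBoxes.
Context {R : realType}.

Lemma Lp_comb_wulff n p lam (K L : set 'rV[R]_n) : Lp_comb p lam K L =
  wulff (fun u => Lp_mean p lam (support_fun K u) (support_fun L u)).
Proof. by rewrite /Lp_comb /Lp_mean; case: ifP. Qed.

Lemma dotv_delta n (x : 'rV[R]_n) i s : dotv x (s *: delta_mx 0 i) = x 0 i * s.
Proof.
rewrite /dotv (bigD1 i)//= big1 ?addr0 => [|k /negbTE ki].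
  by rewrite !mxE !eqxx mulr1.
by rewrite !mxE ki andbF !mulr0.
Qed.

Lemma support_fun_box_delta n (a : 'I_n -> R) i s : (forall i, 0 <= a i) ->
  `|s| = 1 -> support_fun (box a) (s *: delta_mx 0 i) = a i.
Proof.
move=> a0 s1; rewrite support_fun_box// (bigD1 i)//= big1 ?addr0 => [|k /negbTE ki].
  by rewrite !mxE !eqxx mulr1 s1 mulr1.
by rewrite !mxE ki andbF !mulr0 normr0 mulr0.
Qed.

Lemma Lp_comb_box n p lam (a b : 'I_n -> R) : 0 <= p <= 1 -> 0 <= lam <= 1 ->
  (forall i, 0 <= a i) -> (forall i, 0 <= b i) ->
  Lp_comb p lam (box a) (box b) = box (fun i => Lp_mean p lam (a i) (b i)).
Proof.
move=> p01 lam01 a0 b0; rewrite Lp_comb_wulff; apply/seteqP; split => x x_in.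
  move=> i; pose s : R := (-1) ^+ (x 0 i < 0)%R.
  have s1 : `|s| = 1 by rewrite normr_sign.
  have := x_in (s *: delta_mx 0 i).
  rewrite dotv_delta !support_fun_box_delta// mulrC -normrEsign; apply.
  by rewrite /unit_sphere /= dotv_delta !mxE !eqxx mulr1 -expr2 sqrr_sign.
move=> u _; rewrite !support_fun_box//.
apply: le_trans (Lp_mean_sum_le p01 lam01 _ _) => [|i|i]; [|exact: mulr_ge0..].
apply: ler_sum => i _; rewrite ![_ * `|u 0 i|]mulrC (Lp_mean_scale lam01)//.
by rewrite (le_trans (ler_norm _))// normrM mulrC ler_wpM2l.
Qed.

End LpCombinationOfBoxes.

Section SmallWidths.
Context {R : realType}.

Lemma exists_gt0_mulr_expr_lt1 (s : R) k : s < 1 ->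
  exists2 d, 0 < d & s * (1 + s * d) ^+ k < 1.
Proof.
move=> s1; pose q : {poly R} := s%:P * (1 + s *: 'X) ^+ k.
have q0_lt1 : q.[0] < 1 by rewrite !hornerE expr1n mulr1.
have q_lt1 : \forall d \near 0^'+, q.[d] < 1.
  exact: (cvgr_lt q.[0] (cvg_at_right_filter (@continuous_horner _ q 0))).
have [d [dlt d0]] := @filter_ex _ (0^'+) _ _ (filterI q_lt1 (nbhs_right_gt 0)).
by exists d => //; move: dlt; rewrite !hornerE.
Qed.

Lemma exists_elemsym_prepend_ones_lt n k (w : 'I_n -> R) :
  (forall i, 0 <= w i) -> \sum_i w i < 1 ->
  exists2 d, 0 < d & elemsym (prepend_ones k (fun i => d * w i)) k.+1 < d.
Proof.
move=> w0 w1; have [d d0 dlt] := exists_gt0_mulr_expr_lt1 k w1.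
have dw0 i : 0 <= d * w i by rewrite mulr_ge0// ltW.
exists d => //; rewrite -addn1; apply: (le_lt_trans (elemsym_prepend_ones_le _ _ dw0)).
by rewrite expr1 -mulr_sumr -mulrA gtr_pMr// [d * _]mulrC.
Qed.

Lemma le_elemsym_prepend_ones n k (w : 'I_n -> R) d :
  (forall i, 0 <= w i) -> 1 <= \sum_i w i -> 0 <= d ->
  d <= elemsym (prepend_ones k (fun i => d * w i)) k.+1.
Proof.
move=> w0 w1 d0; have dw0 i : 0 <= d * w i by exact: mulr_ge0.
by apply: le_trans (sum_le_elemsym_prepend_ones k dw0); rewrite -mulr_sumr ler_peMr.
Qed.

Lemma exists_Lp_mean_elemsym_lt k m (p lam : R) : 0 <= p < 1 -> 0 < lam < 1 ->
  exists a b : 'I_(k + m.+2) -> R,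
    [/\ forall i, 0 < a i, forall i, 0 < b i &
        elemsym (fun i => Lp_mean p lam (a i) (b i)) k.+1 <
          Num.min (elemsym a k.+1) (elemsym b k.+1)].
Proof.
move=> p01 lam01; have lam01' := lt01W lam01.
have i01 : ord0 != ord_max :> 'I_m.+2 by [].
have [r r0 sum_lt1] := exists_spike_Lp_mean_sum_lt1 i01 p01 lam01.
pose u := spike (@ord0 m.+1) r; pose v := spike (@ord_max m.+1) r.
have u0 i : 0 < u i by exact: spike_gt0.
have v0 i : 0 < v i by exact: spike_gt0.
have [d d0 dlt] :=
  exists_elemsym_prepend_ones_lt k (fun i => Lp_mean_ge0 p lam (u i) (v i)) sum_lt1.
exists (prepend_ones k (fun i => d * u i)), (prepend_ones k (fun i => d * v i)).
split; [by apply: prepend_ones_gt0 => i; exact: mulr_gt0..|].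
rewrite (prepend_ones_map2 (g := Lp_mean p lam)) ?Lp_mean_id//.
have -> : (fun i => Lp_mean p lam (d * u i) (d * v i)) =
    (fun i => d * Lp_mean p lam (u i) (v i)).
  by apply/funext => i; rewrite (Lp_mean_scale lam01')// ltW.
have ge_d i0 : d <= elemsym (prepend_ones k (fun i => d * spike (i0 : 'I_m.+2) r i)) k.+1.
  apply: le_elemsym_prepend_ones; [|exact/sum_spike_ge1/ltW|exact: ltW].
  by move=> i; exact/ltW/spike_gt0.
by apply: lt_le_trans dlt _; rewrite le_min !ge_d.
Qed.

End SmallWidths.

Theorem theorem1p1 (R : realType) (n j : nat) (p lam : R) :
  (3 <= n)%N -> (2 <= j <= n.-1)%N -> 0 <= p < 1 -> 0 < lam < 1 ->
  exists K L : set 'rV[R]_n,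
    [/\ convex_body K, convex_body L, origin_symmetric K, origin_symmetric L &
       (
        intrinsic_volume (Lp_comb p lam K L) j
          < intrinsic_volume K j `^ (1 - lam) * intrinsic_volume L j `^ lam
      /\ intrinsic_volume K j `^ (1 - lam) * intrinsic_volume L j `^ lam
          <= (if p == 0 then
                intrinsic_volume K j `^ (1 - lam) * intrinsic_volume L j `^ lam
              else
                ((1 - lam) * intrinsic_volume K j `^ (p / j%:R)
                 + lam * intrinsic_volume L j `^ (p / j%:R)) `^ (j%:R / p)))].
Proof.
move=> _ /andP[j_ge2 j_lt_n] p01 lam01; have lam01' := lt01W lam01.
have [p_ge0 p_lt1] := andP p01; have p01' : 0 <= p <= 1 by rewrite p_ge0 ltW.
have [k [m [-> ->]]] : exists k m, j = k.+1 /\ n = (k + m.+2)%N.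
  by exists j.-1, (n - j.+1)%N; lia.
have [a [b [a_gt0 b_gt0 elemsym_lt]]] := exists_Lp_mean_elemsym_lt k m p01 lam01.
have a_ge0 i : 0 <= a i by exact: ltW.
have b_ge0 i : 0 <= b i by exact: ltW.
exists (box a), (box b).
split; do ?[exact: convex_body_box | exact: origin_symmetric_box].
have k_lt_n : (k < k + m.+2)%N by rewrite -addn1 leq_add2l.
rewrite Lp_comb_box// !intrinsic_volume_box//; last by move=> i; exact: Lp_mean_ge0.
set VK := 2 ^+ k.+1 * elemsym a _; set VL := 2 ^+ k.+1 * elemsym b _.
have [VK_ge0 VL_ge0] : 0 <= VK /\ 0 <= VL by split; rewrite mulr_ge0 ?elemsym_ge0.
rewrite -Lp_mean0E; split.
  apply: lt_le_trans (min_le_Lp_mean lam01' (lexx 0) VK_ge0 VL_ge0).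
  by rewrite -minr_pMr ?ltr_pM2l.
have [_|p_neq0] := eqVneq p 0; first exact: lexx.
have pj_neq0 : p / k.+1%:R != 0 by rewrite mulf_neq0 ?invr_eq0.
rewrite -[k.+1%:R / p]invf_div -(Lp_meanE _ _ _ pj_neq0).
by apply: (Lp_mean0_le lam01'); rewrite divr_ge0.
Qed.
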